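(* Let $\mathcal{G}$ be a class of graphs that is $\chi$-bounded by a non-decreasing function $f:\mathbb{N}\rightarrow\mathbb{R}$. Then the class $\mathcal{G}^*$ is $\chi$-bounded by the function $g(k)=f(k)^k$.
   Context: All graphs are finite and simple, possibly empty; $\omega$ is the clique number and $\chi$ the chromatic number (both $0$ for the empty graph); $f(0)^0=1$. A class $\mathcal{G}$ is $\chi$-bounded by $f$ if for all $G\in\mathcal{G}$ and all (possibly empty) induced subgraphs $H$ of $G$, $\chi(H)\leq f(\omega(H))$. Given non-empty graphs $G_1,G_2$ with disjoint vertex sets and $u\in V_{G_1}$, the graph obtained by substituting $G_2$ for $u$ in $G_1$ has vertex set $(V_{G_1}\smallsetminus\{u\})\cup V_{G_2}$, induces $G_1\smallsetminus u$ and $G_2$ on the respective parts, and each $v\in V_{G_1}\smallsetminus\{u\}$ is complete to $V_{G_2}$ if $v$ is adjacent to $u$ in $G_1$ and anti-complete to $V_{G_2}$ otherwise. $\mathcal{G}^*$ denotes the closure of $\mathcal{G}$ under taking disjoint unions and substitution. *)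

(* Defs.v *)
From HB Require Import structures.
From mathcomp Require Import all_boot all_order all_algebra.
From mathcomp Require Import reals.

Set Implicit Arguments.
Unset Strict Implicit.
Unset Printing Implicit Defensive.

Import Order.TTheory GRing.Theory Num.Theory.

Record sgraph := SGraph {
  vertex :> finType;
  adj : rel vertex;
  adj_sym : symmetric adj;
  adj_irr : irreflexive adj
}.

Section Induced.
Variables (G : sgraph) (S : {set G}).

Definition induced_adj : rel {x : G | x \in S} :=
  fun x y => adj (val x) (val y).

Fact induced_sym : symmetric induced_adj.
Proof. by move=> x y; apply: adj_sym. Qed.

Fact induced_irr : irreflexive induced_adj.
Proof. by move=> x; apply: adj_irr. Qed.

Definition induced : sgraph := SGraph induced_sym induced_irr.
End Induced.

Definition clique (G : sgraph) (A : {set G}) : bool :=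
  [forall x in A, forall y in A, (x != y) ==> adj x y].

Definition omega (G : sgraph) : nat := \max_(A : {set G} | clique A) #|A|.

Definition colorable (G : sgraph) (k : nat) : bool :=
  [exists c : {ffun G -> 'I_k},
    [forall x, forall y, adj x y ==> (c x != c y)]].

Fact colorable_card (G : sgraph) : exists k, colorable G k.
Proof.
exists #|G|; apply/existsP; exists [ffun x => enum_rank x].
apply/forallP => x; apply/forallP => y; apply/implyP => xy.
rewrite !ffunE (inj_eq enum_rank_inj).
by apply: contraTneq xy => ->; rewrite adj_irr.
Qed.

Definition chi (G : sgraph) : nat := ex_minn (colorable_card G).

Section DisjointUnion.
Variables G1 G2 : sgraph.

Definition union_adj : rel (G1 + G2)%type := fun a b =>
  match a, b with
  | inl x, inl y => adj x y
  | inr x, inr y => adj x y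
  | _, _ => false
  end.

Fact union_sym : symmetric union_adj.
Proof. by case=> x [] y //=; apply: adj_sym. Qed.

Fact union_irr : irreflexive union_adj.
Proof. by case=> x /=; apply: adj_irr. Qed.

Definition disjoint_union : sgraph := SGraph union_sym union_irr.
End DisjointUnion.

Section Substitution.
Variables (G1 : sgraph) (u : G1) (G2 : sgraph).

Definition subst_adj : rel (induced [set~ u] + G2)%type := fun a b =>
  match a, b with
  | inl x, inl y => adj x y
  | inr x, inr y => adj x y
  | inl x, inr _ | inr _, inl x => adj (val x) u
  end.

Fact subst_sym : symmetric subst_adj.
Proof. by case=> x [] y //=; apply: adj_sym. Qed.

Fact subst_irr : irreflexive subst_adj.
Proof. by case=> x /=; apply: adj_irr. Qed.

Definition substitution : sgraph := SGraph subst_sym subst_irr.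
End Substitution.

Definition isomorphic (G H : sgraph) : Prop :=
  exists2 h : G -> H, bijective h & forall x y, adj (h x) (h y) = adj x y.

(* Sum types only give one copy of the disjoint union and of the substitution;
   [star_iso] accounts for the renamings of vertices implicit in the requirement
   that the two graphs have disjoint vertex sets. *)
Inductive star (C : sgraph -> Prop) : sgraph -> Prop :=
  | star_base G : C G -> star C G
  | star_iso G H : isomorphic G H -> star C G -> star C H
  | star_union G1 G2 :
      star C G1 -> star C G2 -> star C (disjoint_union G1 G2)
  | star_subst (G1 : sgraph) (u : G1) (G2 : sgraph) :
      star C G1 -> star C G2 -> (0 < #|G2|)%N -> star C (substitution u G2).

Definition chi_bounded (R : realType) (C : sgraph -> Prop) (f : nat -> R)
    : Prop :=
  forall G, C G -> forall S : {set G},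
    ((chi (induced S))%:R <= f (omega (induced S)))%R.

(* Main.v *)
Require Import Defs.
From mathcomp Require Import all_boot all_order all_algebra.
From mathcomp Require Import reals.

Set Implicit Arguments.
Unset Strict Implicit.
Unset Printing Implicit Defensive.

Import Order.TTheory GRing.Theory Num.Theory.
Local Open Scope ring_scope.

(** Call a set of vertices tame if it satisfies the bound [chi <= f omega ^+ omega],
    and call a graph [G] tame-closed if every graph obtained by replacing each
    vertex of [G] by a tame (possibly empty) graph is again tame.  Being
    tame-closed is visibly preserved by substitution and disjoint union, since
    replacing the vertices of a substitution amounts to replacing the vertices
    of [G1], one of them by a graph obtained from [G2].  A graph [G] of the base
    class is tame-closed because of the product colouring: let [k] be the clique
    number of the expanded graph.  A fibre over a non-isolated vertex has
    clique number at most [k - 1], so [f k * f k ^+ (k - 1)] colours suffice for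
    these fibres, while each fibre over an isolated vertex is coloured on its own
    with [f k ^+ k] colours.  The theorem is the case of one-vertex fibres. *)

(** * Cliques and colourings of induced subgraphs *)

Lemma cliqueP (G : sgraph) (A : {set G}) :
  reflect {in A &, forall x y, x != y -> adj x y} (clique A).
Proof.
apply: (iffP forall_inP) => [cA x y xA yA xy|cA x xA].
  by move/forall_inP: (cA x xA) => /(_ y yA) /implyP; apply.
by apply/forall_inP => y yA; apply/implyP; apply: cA.
Qed.

Section InducedInvariants.
Variable G : sgraph.
Implicit Types (S A : {set G}) (c : G -> nat).

Lemma card_clique_le_omega S A :
  A \subset S -> clique A -> (#|A| <= omega (induced S))%N.
Proof.
move=> /subsetP AS /cliqueP cA.
pose B : {set induced S} := [set x | val x \in A].
have -> : #|A| = #|B|.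
  rewrite -(card_imset B val_inj); congr #|pred_of_set _|.
  apply/setP => x; apply/idP/imsetP => [xA|[y]]; last by rewrite inE => ? ->.
  by exists (Sub x (AS x xA)); rewrite ?inE SubK.
apply: (@leq_bigmax_cond _ (@clique (induced S)) (fun B => #|B|) B).
apply/cliqueP => x y; rewrite !inE => xA yA xy.
exact: cA.
Qed.

Lemma omega_clique S :
  exists A : {set G}, [/\ A \subset S, clique A & #|A| = omega (induced S)].
Proof.
have [|B cB omegaE] := @eq_bigmax_cond _ (@clique (induced S)) (fun B => #|B|).
  by apply/card_gt0P; exists set0; apply/cliqueP => x y; rewrite inE.
exists (val @: B); split.
- by apply/subsetP => _ /imsetP[x _ ->]; apply: valP.
- apply/cliqueP => _ _ /imsetP[x xB ->] /imsetP[y yB ->] xy.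
  by move/cliqueP: cB; apply=> //; apply: contra_neq xy => ->.
- by rewrite card_imset -?omegaE //; apply: val_inj.
Qed.

Lemma omega_gt0 S x : x \in S -> (0 < omega (induced S))%N.
Proof.
move=> xS; rewrite -(cards1 x); apply: card_clique_le_omega.
  by rewrite sub1set.
by apply/cliqueP => y z /set1P-> /set1P->; rewrite eqxx.
Qed.

Lemma omega_le_card S : (omega (induced S) <= #|S|)%N.
Proof. by have [A [AS _ <-]] := omega_clique S; apply: subset_leq_card. Qed.

Lemma omega_subset S S' :
  S \subset S' -> (omega (induced S) <= omega (induced S'))%N.
Proof.
have [A [AS cA <-]] := omega_clique S => SS'.
exact/card_clique_le_omega/cA/(subset_trans AS).
Qed.

(** Colourings are total functions on [G], constrained only on [S], so that colourings of different
    induced subgraphs can be combined without subset types. *)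
Lemma chi_le S c (n : nat) :
    {in S, forall x, (c x < n)%N} ->
    {in S &, forall x y, adj x y -> c x != c y} ->
  (chi (induced S) <= n)%N.
Proof.
move=> cn cP; rewrite /chi; case: ex_minnP => m _; apply.
apply/existsP; exists [ffun x : induced S => Ordinal (cn _ (valP x))].
apply/forallP => x; apply/forallP => y; apply/implyP => xy.
rewrite !ffunE -val_eqE; apply: cP => //; exact: valP.
Qed.

Lemma chi_coloring S :
  exists c : G -> nat, {in S, forall x, (c x < chi (induced S))%N} /\
    {in S &, forall x y, adj x y -> c x != c y}.
Proof.
rewrite /chi; case: ex_minnP => m /existsP[c /forallP cP] _.
exists (fun x => oapp (fun x : induced S => c x : nat) 0 (insub x)).
split=> [x xS|x y xS yS xy]; first by rewrite insubT /=.
rewrite !insubT /=; move/forallP: (cP (Sub x xS)) => /(_ (Sub y yS)).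
by move/implyP; apply.
Qed.

Lemma chi_set0 : chi (induced (set0 : {set G})) = 0%N.
Proof. by apply/eqP; rewrite -leqn0 (@chi_le _ (fun=> 0%N)) // => x; rewrite inE. Qed.

End InducedInvariants.

(** * Tame sets and expansions *)

Section TameSets.
Variables (R : realType) (f : nat -> R).
Hypothesis f_nondecreasing : forall m n : nat, (m <= n)%N -> f m <= f n.
Hypothesis f1_ge1 : 1 <= f 1%N.

Definition tame (X : sgraph) (S : {set X}) : Prop :=
  (chi (induced S))%:R <= f (omega (induced S)) ^+ omega (induced S).

Lemma tame_set0 (X : sgraph) : tame (set0 : {set X}).
Proof.
have omega0 : omega (induced (set0 : {set X})) = 0%N.
  by apply/eqP; rewrite -leqn0 -(cards0 X) omega_le_card.
by rewrite /tame chi_set0 omega0 ler01.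
Qed.

Lemma f_ge1 n : (0 < n)%N -> 1 <= f n.
Proof. by move=> n_gt0; apply: le_trans f1_ge1 (f_nondecreasing n_gt0). Qed.

(** Enlarge the base by monotonicity, then the exponent, using [1 <= f k]. *)
Lemma f_expr_le m n k : (m <= n <= k)%N -> f m ^+ m <= f k ^+ n.
Proof.
(* Nothing bounds [f 0] from below here, so [m = 0] is treated apart: the left side is then 1. *)
case: m => [|m] /andP[mn nk].
  case: n nk mn => [|n] nk _; rewrite expr0 ?expr0 // exprn_ege1 //.
  exact/f_ge1/leq_trans/nk.
have fm1 : 1 <= f m.+1 by apply: f_ge1.
have mk : f m.+1 <= f k by apply/f_nondecreasing/leq_trans/nk.
have f_ge0 : 0 <= f m.+1 by apply: le_trans fm1.
apply: (@le_trans _ _ (f k ^+ m.+1)).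
  by apply: lerXn2r; rewrite ?nnegrE // (le_trans f_ge0).
by apply: ler_weXn2l => //; apply: le_trans mk.
Qed.

(* The vertices mapped to [None] are discarded: the fibres of [p] over [G] are
   the graphs replacing the vertices of [G]. *)
Definition expansion (X G : sgraph) (p : X -> option G) : Prop :=
  forall x y a b, p x = Some a -> p y = Some b -> a != b -> adj x y = adj a b.

Definition fiber (X G : sgraph) (p : X -> option G) (v : G) : {set X} :=
  [set x | p x == Some v].

Definition tame_closed (G : sgraph) : Prop :=
  forall (X : sgraph) (p : X -> option G), expansion p ->
    (forall v, tame (fiber p v)) -> tame [set x | p x != None].

(** Choose one vertex in each fibre over [B]: vertices of distinct fibres are adjacent exactly when
    their images are. *)
Lemma expansion_clique (X G : sgraph) (p : X -> option G) (B : {set G}) :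
    expansion p -> clique B ->
    (forall v, v \in B -> exists x, p x = Some v) ->
  exists A : {set X}, [/\ clique A, #|A| = #|B| &
    forall x, x \in A -> exists2 v, v \in B & p x = Some v].
Proof.
move=> pE /cliqueP cB pB.
pose q v := [pick x | p x == Some v].
pose A := [set x | [exists v in B, q v == Some x]].
have qP v x : q v = Some x -> p x = Some v.
  by rewrite /q; case: pickP => // y /eqP pv [<-].
have AP x : x \in A -> exists2 v, v \in B & q v = Some x.
  by rewrite inE => /exists_inP[v vB /eqP]; exists v.
exists A; split=> [||x /AP[v vB /qP]]; last by exists v.
  apply/cliqueP => x y /AP[v vB qv] /AP[w wB qw] xy.
  have vw : v != w by apply: contra_neq xy => vw; apply: Some_inj; rewrite -qv vw.
  by rewrite (pE _ _ _ _ (qP _ _ qv) (qP _ _ qw)) //; apply: cB.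
have Some_p : {in A &, injective p}.
  move=> x y /AP[v vB qv] /AP[w wB qw]; rewrite (qP _ _ qv) (qP _ _ qw) => -[vw].
  by apply: Some_inj; rewrite -qv -qw vw.
rewrite -(card_in_imset Some_p) -(card_imset B (@Some_inj _)).
congr #|pred_of_set _|; apply/setP => o; apply/imsetP/imsetP => -[].
  by move=> x /AP[v vB /qP ->] ->; exists v.
move=> v vB ->; case qv: (q v) => [x|].
  exists x; last by rewrite (qP _ _ qv).
  by rewrite inE; apply/exists_inP; exists v; rewrite ?qv.
have [x pv] := pB v vB.
by move: qv; rewrite /q; case: pickP => // /(_ x); rewrite pv eqxx.
Qed.

(** * Base graphs and the product colouring *)

Lemma tame_closed_base (G : sgraph) :
    (forall S : {set G}, (chi (induced S))%:R <= f (omega (induced S))) ->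
  tame_closed G.
Proof.
move=> Gf X p pE tF; set T := [set x | _].
have [->|[x0 x0T]] := set_0Vmem T; first exact: tame_set0.
have pT x v : p x = Some v -> x \in T by rewrite inE => ->.
(* Only the vertices with a nonempty fibre count: cliques in [W] lift to cliques in [T]. *)
pose W : {set G} := [set v | [exists x, p x == Some v]].
have pW x v : p x = Some v -> v \in W.
  by move=> pv; rewrite inE; apply/existsP; exists x; apply/eqP.
have WP v : v \in W -> exists x, p x = Some v.
  by rewrite inE => /existsP[x /eqP]; exists x.
set k := omega (induced T).
have k_gt0 : (0 < k)%N by apply: omega_gt0 x0T.
have omegaW : (omega (induced W) <= k)%N.
  have [B [/subsetP BW cB <-]] := omega_clique W.
  have [A [cA <- AB]] := expansion_clique pE cB (fun v vB => WP v (BW v vB)).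
  by apply: card_clique_le_omega cA; apply/subsetP => x /AB[v _]; apply: pT.
have omegaF v : (omega (induced (fiber p v)) <= k)%N.
  by apply/omega_subset/subsetP => x; rewrite inE => /eqP/pT.
(* Any vertex of the fibre over [w] extends every clique in the fibre over [v]. *)
have omegaF_lt v w : w \in W -> adj v w -> (omega (induced (fiber p v)) < k)%N.
  move=> /WP[x px] vw.
  have [A [/subsetP AF cA <-]] := omega_clique (fiber p v).
  have Ap y : y \in A -> p y = Some v by move/AF; rewrite inE => /eqP.
  have v_neq_w : v != w by apply: contraTneq vw => ->; rewrite adj_irr.
  have Ax y : y \in A -> adj y x by move=> /Ap py; rewrite (pE _ _ _ _ py px).
  have xA : x \notin A by apply/negP => /Ax; rewrite adj_irr.
  have -> : #|A|.+1 = #|x |: A| by rewrite cardsU1 xA.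
  apply: card_clique_le_omega.
    by apply/subsetP => y /setU1P[->|/Ap]; [apply: pT px|apply: pT].
  apply/cliqueP => y z /setU1P[->|yA] /setU1P[->|zA]; rewrite ?eqxx // => yz.
  - by rewrite adj_sym; apply: Ax.
  - exact: Ax.
  - by move/cliqueP: cA; apply.
have [c [cW cP]] := chi_coloring W.
have /fin_all_exists[d dP] v := chi_coloring (fiber p v).
have f_pow_ge0 n : 0 <= f k ^+ n by rewrite exprn_ge0 // (le_trans ler01) ?f_ge1.
(* Chromatic numbers are integers, so the real bounds can be rounded down and colours counted in
   [nat]. *)
pose L := Num.truncn (f k ^+ k); pose M := Num.truncn (f k ^+ k.-1).
have NML : (chi (induced W) * M <= L)%N.
  have f_exprS : f k ^+ k = f k * f k ^+ k.-1 by rewrite -exprS prednK.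
  rewrite truncn_ge_nat // natrM f_exprS.
  apply: ler_pM => //; last by rewrite /M truncn_le.
  exact: le_trans (Gf W) (f_nondecreasing omegaW).
have dL v x : p x = Some v -> (d v x < L)%N.
  move=> pv; apply: leq_trans (proj1 (dP v) x _) _; first by rewrite inE pv.
  rewrite truncn_ge_nat //; apply: le_trans (tF v) _.
  by rewrite f_expr_le // omegaF leqnn.
have dM v w x : w \in W -> adj v w -> p x = Some v -> (d v x < M)%N.
  move=> wW vw pv; apply: leq_trans (proj1 (dP v) x _) _; first by rewrite inE pv.
  rewrite truncn_ge_nat //; apply: le_trans (tF v) _.
  by rewrite f_expr_le // leq_pred -ltnS prednK // (omegaF_lt _ _ wW vw).
(* If [v] has a neighbour in [W], the pair of colours [c v] and [d v x] is encoded in base [M].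
   Otherwise the fibre over [v] has no neighbours outside itself; it may need more than [M] colours,
   and [d v] alone is used. *)
pose col x := if p x is Some v then
  if [exists w in W, adj v w] then (c v * M + d v x)%N else d v x else 0%N.
suff chiL : (chi (induced T) <= L)%N.
  by apply: le_trans (_ : L%:R <= _); rewrite ?ler_nat // /L truncn_le.
apply: (@chi_le _ _ col) => [x|x y]; rewrite /col !inE.
  case px: (p x) => [v|] // _; case: exists_inP => [[w wW vw]|_]; last exact: dL.
  apply: leq_trans NML; apply: (@leq_trans ((c v).+1 * M)).
    by rewrite mulSn addnC ltn_add2r (dM _ _ _ wW vw).
  by rewrite leq_mul2r cW ?orbT // (pW _ _ px).
case px: (p x) => [v|] // _; case py: (p y) => [w|] // _ xy.
have [vw|v_neq_w] := eqVneq v w.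
  have dxy : d v x != d v y.
    by apply: (proj2 (dP v)) xy; rewrite inE ?px ?py vw.
  by rewrite -vw; case: ifP => _ //; rewrite eqn_add2l.
have vw : adj v w by rewrite -(pE _ _ _ _ px py).
have wv : adj w v by rewrite adj_sym.
have [vW wW] := (pW _ _ px, pW _ _ py).
have -> : [exists z in W, adj v z] by apply/exists_inP; exists w.
have -> : [exists z in W, adj w z] by apply/exists_inP; exists v.
have [dx dy] := (dM _ _ _ wW vw px, dM _ _ _ vW wv py).
have M_gt0 : (0 < M)%N by apply: leq_ltn_trans dx.
(* The quotient by [M] recovers the colours [c v] and [c w], which differ. *)
apply: contraNneq (cP _ _ vW wW vw) => /(congr1 (divn^~ M)).
by rewrite !divnMDl // !divn_small // !addn0 => ->.
Qed.

(** * Closure under isomorphism, disjoint union and substitution *)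

Lemma tame_closed_iso (G H : sgraph) :
  isomorphic G H -> tame_closed G -> tame_closed H.
Proof.
move=> [h [h' hK h'K] hE] tG X p pE tF.
have -> : [set x | p x != None] = [set x | omap h' (p x) != None].
  by apply/setP => x; rewrite !inE; case: (p x).
apply: tG => [x y a b|v].
  case px: (p x) => [v|] //; case py: (p y) => [w|] // [<-] [<-] ab.
  rewrite (pE _ _ _ _ px py) -?hE ?h'K //.
  by apply: contra_neq ab => ->.
have -> : fiber (fun x => omap h' (p x)) v = fiber p (h v); last exact: tF.
apply/setP => x; rewrite !inE; case: (p x) => [w|] //=.
by rewrite !(inj_eq Some_inj) (can2_eq h'K hK).
Qed.

(** Both sets can share their colours, so the larger chromatic number suffices, and both clique
    numbers are at most that of the union. *)
Lemma tame_anticomplete (X : sgraph) (S T : {set X}) :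
    {in S & T, forall x y, ~~ adj x y} ->
  tame S -> tame T -> tame (S :|: T).
Proof.
move=> ST tS tT.
have [c [cS cP]] := chi_coloring S; have [d [dT dP]] := chi_coloring T.
pose e x := if x \in S then c x else d x.
have : (chi (induced (S :|: T)) <= maxn (chi (induced S)) (chi (induced T)))%N.
  apply: (@chi_le _ _ e) => [x|x y]; rewrite /e !inE.
    by case: ifP => [xS _|_ xT]; rewrite leq_max ?cS ?dT ?orbT.
  case: ifP => [xS _|_ /= xT]; case: ifP => [yS _|_ /= yT] xy.
  - exact: cP.
  - by have := ST _ _ xS yT; rewrite xy.
  - by have := ST _ _ yS xT; rewrite adj_sym xy.
  - exact: dP.
rewrite -(ler_nat R) => /le_trans; apply.
by case: (leqP (chi (induced S)) _) => _;
  [apply: le_trans tT _|apply: le_trans tS _];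
  rewrite f_expr_le // leqnn omega_subset ?subsetUl ?subsetUr.
Qed.

Lemma tame_closed_union (G1 G2 : sgraph) :
  tame_closed G1 -> tame_closed G2 -> tame_closed (disjoint_union G1 G2).
Proof.
move=> t1 t2 X p pE tF.
pose p1 x := if p x is Some (inl v) then Some v else None.
pose p2 x := if p x is Some (inr v) then Some v else None.
have p1P x v : p1 x = Some v -> p x = Some (inl v).
  by rewrite /p1; case: (p x) => [[]|] // ? [->].
have p2P x v : p2 x = Some v -> p x = Some (inr v).
  by rewrite /p2; case: (p x) => [[]|] // ? [->].
have -> : [set x | p x != None] = [set x | p1 x != None] :|: [set x | p2 x != None].
  by apply/setP => x; rewrite !inE /p1 /p2; case: (p x) => [[]|].
apply: tame_anticomplete.
- move=> x y; rewrite !inE; case p1x: (p1 x) => [v|] // _.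
  case p2y: (p2 y) => [w|] // _.
  by rewrite (pE _ _ _ _ (p1P _ _ p1x) (p2P _ _ p2y)).
- apply: t1 => [x y a b /p1P px /p1P py ab|v]; first by rewrite (pE _ _ _ _ px py).
  have -> : fiber p1 v = fiber p (inl v); last exact: tF.
  by apply/setP => x; rewrite !inE /p1; case: (p x) => [[]|].
- apply: t2 => [x y a b /p2P px /p2P py ab|v]; first by rewrite (pE _ _ _ _ px py).
  have -> : fiber p2 v = fiber p (inr v); last exact: tF.
  by apply/setP => x; rewrite !inE /p2; case: (p x) => [[]|].
Qed.

Lemma tame_closed_subst (G1 : sgraph) (u : G1) (G2 : sgraph) :
  tame_closed G1 -> tame_closed G2 -> tame_closed (substitution u G2).
Proof.
move=> t1 t2 X p pE tF.
(* Collapsing the copy of [G2] to [u] turns [p] into an expansion [p1] of [G1]. *)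
pose base (a : substitution u G2) : G1 := if a is inl v then val v else u.
pose p1 x := omap base (p x).
pose p2 x := if p x is Some (inr v) then Some v else None.
have p2P x v : p2 x = Some v -> p x = Some (inr v).
  by rewrite /p2; case: (p x) => [[]|] // ? [->].
have neq_u (v : induced [set~ u]) : val v != u by have := valP v; rewrite !inE.
have -> : [set x | p x != None] = [set x | p1 x != None].
  by apply/setP => x; rewrite !inE /p1; case: (p x).
apply: t1 => [x y a b|v].
  rewrite /p1; case px: (p x) => [a'|] //; case py: (p y) => [b'|] // [<-] [<-] ab.
  rewrite (pE _ _ _ _ px py); last by apply: contra_neq ab => ->.
  case: a' b' ab {px py} => [v|v] [w|w] //=; last by rewrite eqxx.
  by move=> _; apply: adj_sym.
(* The fibre of [p1] over [u] is an expansion of [G2], hence tame by [t2]; every other fibre of [p1]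
   is already a fibre of [p]. *)
have [->|vu] := eqVneq v u.
  have -> : fiber p1 u = [set x | p2 x != None].
    apply/setP => x; rewrite !inE /p1 /p2; case: (p x) => [[w|w]|] //=.
      by rewrite (inj_eq Some_inj) (negPf (neq_u w)).
    by rewrite eqxx.
  apply: t2 => [x y a b /p2P px /p2P py ab|w]; first by rewrite (pE _ _ _ _ px py).
  have -> : fiber p2 w = fiber p (inr w); last exact: tF.
  by apply/setP => x; rewrite !inE /p2; case: (p x) => [[]|].
have vS : v \in [set~ u] by rewrite !inE.
have -> : fiber p1 v = fiber p (inl (Sub v vS)); last exact: tF.
apply/setP => x; rewrite !inE /p1; case: (p x) => [[w|w]|] //=.
by rewrite (inj_eq Some_inj) eq_sym (negPf vu).
Qed.

(** * One-vertex fibres and the final bound *)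

Lemma tame_set1 (X : sgraph) (x : X) : tame [set x].
Proof.
apply: (@le_trans _ _ 1); last first.
  (* Writing 1 as [f 0 ^+ 0] makes this an instance of [f_expr_le]. *)
  by rewrite -(expr0 (f 0)) f_expr_le //= leqnn.
rewrite -[1]/(1%:R) ler_nat (@chi_le _ _ (fun=> 0%N)) // => y z /set1P-> /set1P->.
by rewrite adj_irr.
Qed.

(** [S] is the expansion of [G] with singleton fibres over [S] and empty fibres elsewhere. *)
Lemma tame_closed_tame (G : sgraph) (S : {set G}) : tame_closed G -> tame S.
Proof.
move=> tG; pose p x := if x \in S then Some x else None.
have -> : S = [set x | p x != None] by apply/setP => x; rewrite inE /p; case: ifP.
apply: tG => [x y a b|v].
  by rewrite /p; case: ifP => // _ [->]; case: ifP => // _ [->].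
have [vS|vS] := boolP (v \in S).
  have -> : fiber p v = [set v]; last exact: tame_set1.
  apply/setP => x; rewrite !inE /p; case: ifPn => [_|xS].
    by rewrite (inj_eq Some_inj).
  by apply/esym/negbTE; apply: contraNneq xS => ->.
have -> : fiber p v = set0; last exact: tame_set0.
apply/setP => x; rewrite !inE /p; case: ifPn => // xS.
by apply/negbTE; apply: contraNneq vS => -[<-].
Qed.

Lemma star_tame_closed (C : sgraph -> Prop) (G : sgraph) :
  chi_bounded C f -> star C G -> tame_closed G.
Proof.
move=> Cf; elim=> {G} [G CG|G H GH _|G1 G2 _ t1 _|G1 u G2 _ t1 _ t2 _].
- exact/tame_closed_base/Cf.
- exact: tame_closed_iso.
- exact: tame_closed_union.
- exact: tame_closed_subst.
Qed.

End TameSets.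

(** This supplies the nonempty base graph from which [1 <= f 1] follows. For a substitution, [G1] is
    nonempty because it contains [u]. *)
Lemma star_nonempty (C : sgraph -> Prop) (G : sgraph) :
  star C G -> G -> exists2 H, C H & inhabited H.
Proof.
elim=> {G} [G CG x|G H [h [h' _ _] _] _ IH x|G1 G2 _ IH1 _ IH2 [x|x]|].
- by exists G.
- exact: IH (h' x).
- exact: IH1.
- exact: IH2.
- by move=> G1 u G2 _ IH1 _ _ _ _; apply: IH1.
Qed.

(** A single vertex needs a colour and has clique number at most 1. *)
Lemma chi_bounded_f1 (R : realType) (C : sgraph -> Prop) (f : nat -> R)
    (G : sgraph) (x : G) :
    (forall m n : nat, (m <= n)%N -> f m <= f n) -> chi_bounded C f -> C G ->
  1 <= f 1%N.
Proof.
move=> f_nondecreasing Cf CG.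
have [c [cx _]] := chi_coloring [set x].
apply: (@le_trans _ _ (chi (induced [set x]))%:R).
  by rewrite -[1]/(1%:R) ler_nat (leq_ltn_trans _ (cx x (set11 x))).
apply: le_trans (Cf G CG [set x]) _; apply: f_nondecreasing.
by rewrite -(cards1 x) omega_le_card.
Qed.

Theorem theorem2p2 (R : realType) (C : sgraph -> Prop) (f : nat -> R)
  (f_nondecreasing : forall m n : nat, (m <= n)%N -> f m <= f n)
  (C_bounded : chi_bounded C f) :
  chi_bounded (star C) (fun k : nat => f k ^+ k).
Proof.
(* The empty set is handled first, since [1 <= f 1] may fail when [C] has no nonempty graph. *)
move=> G sG S; have [->|[x _]] := set_0Vmem S; first exact: tame_set0.
have [H CH [y]] := star_nonempty sG x.
have f1_ge1 := chi_bounded_f1 y f_nondecreasing C_bounded CH.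
apply: tame_closed_tame => //.
exact: star_tame_closed C_bounded sG.
Qed.
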